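(* Let $G$ be a finite group and let $p$ be a fixed prime divisor of $|G|$. Suppose that every maximal subgroup of $G$ is nilpotent, or normal in $G$, or has order not divisible by $p$. Then there exists at most one prime divisor $q$ of $|G|$ with $q\neq p$ such that $G$ is neither $q$-nilpotent nor $q$-closed.
   Context: For a prime $q$, a finite group $G$ is $q$-nilpotent if it has a normal $q$-complement (a normal subgroup of order coprime to $q$ and index a power of $q$), and $q$-closed if its Sylow $q$-subgroup is normal in $G$. *)

(* Defs.v *)
From mathcomp Require Import all_boot all_fingroup all_solvable.
Set Implicit Arguments. Unset Strict Implicit. Unset Printing Implicit Defensive.
Local Open Scope group_scope.

Definition q_nilpotent (gT : finGroupType) (q : nat) (G : {set gT}) : Prop :=
  exists K : {group gT}, K <| G /\ coprime #|K| q /\ q.-nat #|G : K|.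

Definition q_closed (gT : finGroupType) (q : nat) (G : {set gT}) : Prop :=
  exists P : {group gT}, P \in 'Syl_q(G) /\ P <| G.

(* Main.v *)
Require Import Defs.
From mathcomp Require Import all_boot all_fingroup all_solvable ssralg finalg.
Set Implicit Arguments. Unset Strict Implicit. Unset Printing Implicit Defensive.
Local Open Scope group_scope.

(** In fact no prime [q <> p] is exceptional.

    Solvability.  In a minimal counterexample [G] no nontrivial normal subgroup
    is solvable; let [N] be minimal normal, so that [N] is perfect.  For a
    Sylow subgroup [S] of [N], a maximal subgroup [L] over ['N_G(S)] is not
    normal (Frattini), hence nilpotent as soon as [p] divides its order.  If a
    second prime [t] divides [#|L|], the Sylow [t]-subgroup of [L] forces the
    [N]-fusion in [S] to be induced by [S], and the transfer contradicts
    [N' = N].  Such [S] and [t] exist unless [G = N] is simple; then normalisers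
    of nontrivial [p]-subgroups are nilpotent, so Sylow [p]-subgroups are TI
    with nilpotent normalisers, and transfer applies again.

    Conclusion.  Let [M] be maximal, nilpotent and not normal, with core [C].
    A minimal normal subgroup of [G / C] is an [r]-group and [G / C] has a
    normal Sylow [r]-subgroup [R C / C].  If [R] is normal in [G], then [G / R]
    is nilpotent and we are done.  Otherwise a maximal subgroup [L] over
    ['N_G(R)] satisfies [C L = G] and is neither normal nor nilpotent, so it is
    a [p']-group.  Hence the Sylow [p]-subgroup [P] of [C] is Sylow and normal
    in [G], it is complemented by [L], and it is central; the argument applied
    to [G / P] then succeeds, because [L] has no analogue there.  If there is no
    such [M], then [P] is normal and [G / P] is nilpotent. *)

(** * Transfer and fusion in a Sylow subgroup *)

Lemma sylow_fusion_der1 (gT : finGroupType) (p : nat) (G S : {group gT}) :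
  p.-Sylow(G) S ->
  (forall x g, x \in S -> g \in G -> x ^ g \in S ->
    exists2 u, u \in S & x ^ g = x ^ u) ->
  S :&: G^`(1) \subset S^`(1).
Proof.
move=> sylS fus; have sSG := pHall_sub sylS; have pS := pHall_pgroup sylS.
have nS'S : S \subset 'N(S^`(1)) := gFnorm _ _.
pose al := restrm_morphism nS'S (coset_morphism S^`(1)).
have imal : al @* S = S / S^`(1) by rewrite /= morphim_restrm setIid.
have abA : abelian (al @* S) by rewrite imal der_abelian.
have sSpre : S \subset al @*^-1 (al @* S) by rewrite -sub_morphim_pre.
pose f := restrm sSpre (FiniteModule.fmod abA \o al).
have fE x : f x = FiniteModule.fmod abA (coset S^`(1) x) by [].
have inA x : x \in S -> coset S^`(1) x \in al @* S.
  by move=> Sx; rewrite imal mem_quotient.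
have fJ x u : x \in S -> u \in S -> f (x ^ u) = f x.
  move=> Sx Su; rewrite !fE; congr (FiniteModule.fmod _ _).
  rewrite morphJ ?(subsetP nS'S) //; apply: conjg_fixP.
  by apply/commgP; apply: (centsP abA); apply: inA.
have fX x n : x \in S -> f (x ^+ n) = (f x *+ n)%R.
  by move=> Sx; rewrite !fE morphX ?(subsetP nS'S) ?FiniteModule.fmodX ?inA.
have trE x : x \in S -> transfer G abA x = (f x *+ #|G : S|)%R.
  move=> Sx; have Gx := subsetP sSG x Sx.

  have trX := transversalP (rcosets_cycle_partition sSG Gx).
  (* Each term is the value of [f] at a conjugate of [x ^+ n] lying in [S]; by [fus] it is an
     [S]-conjugate, which [f] does not distinguish from [x ^+ n]. The orbit lengths [n] add up to
     [#|G : S|]. *)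
  rewrite (transfer_cycle_expansion sSG abA Gx trX).
  rewrite -(sum_index_rcosets_cycle sSG Gx trX) -GRing.sumrMnr.
  apply: eq_bigr => z Xz.
  have Gz : z \in G by apply: (subsetP (transversal_sub trX)).
  set n := #|_ : _|.
  have Sxn : x ^+ n \in S by rewrite groupX.
  have [|||u Su ->] := fus (x ^+ n) z^-1; rewrite ?groupV //.
    by rewrite conjgE invgK mulgA -mem_rcoset mulg_exp_card_rcosets.
  by rewrite -[LHS]/(f ((x ^+ n) ^ u)) fJ ?fX.
apply/subsetP => x /setIP[Sx G'x].
have tr0 : transfer G abA x = 0%R.
  pose V := transfer_morphism G abA.
  have : V @* G^`(1) \subset [1].
    rewrite morphimR //; apply/trivgP/commG1P.
    exact: FinRing.zmod_abelian.
  move/subsetP/(_ (V x)); rewrite mem_morphim ?(subsetP (der_sub 1 G)) //.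
  by move/(_ isT)/set1P.
have y1 : coset S^`(1) x ^+ #|G : S| = 1.
  rewrite -(FiniteModule.fmodK abA (groupX _ (inA x Sx))) FiniteModule.fmodX ?inA //.
  by rewrite -fE -trE // tr0.
have coA : coprime #|S / S^`(1)| #|G : S|.
  apply: (@pnat_coprime p); first exact: quotient_pgroup.
  by case/and3P: sylS.
apply: coset_idr; first exact: (subsetP nS'S).
have Sy : coset S^`(1) x \in S / S^`(1) by rewrite mem_quotient.
by rewrite -(expgK coA Sy) y1 expg1n.
Qed.

Lemma fusion_der1_neq (gT : finGroupType) (p : nat) (G S : {group gT}) :
  p.-Sylow(G) S -> S :!=: 1 ->
  (forall x g, x \in S -> g \in G -> x ^ g \in S ->
    exists2 u, u \in S & x ^ g = x ^ u) ->
  G^`(1) != G.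
Proof.
move=> sylS ntS fus; apply/eqP => G'G.
have := sylow_fusion_der1 sylS fus; rewrite G'G (setIidPl (pHall_sub sylS)) => sSS'.
have := sol_der1_proper (pgroup_sol (pHall_pgroup sylS)) (subxx _) ntS.
by rewrite properE sSS' andbF.
Qed.

(** In [H = 'O_p^'(H) \x S], the first factor of [v] centralises [S], so the second one serves as
    [u]. *)
Lemma nilpotent_Sylow_fusion (gT : finGroupType) (p : nat) (H S : {group gT}) x v :
  nilpotent H -> p.-Sylow(H) S -> x \in S -> v \in H ->
  exists2 u, u \in S & x ^ v = x ^ u.
Proof.
move=> nilH sylS Sx; rewrite -{1}(dprodWC (nilpotent_pcoreC p nilH)).
rewrite -(nilpotent_Hall_pcore nilH sylS) => /mulsgP[w u Ww Su ->].
exists u => //; rewrite conjgM; congr (_ ^ u); apply/conjg_fixP/commgP.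
have [_ _ cWS _] := dprodP (nilpotent_pcoreC p nilH).
apply: commute_sym; apply: (centsP cWS) => //.
by rewrite -(nilpotent_Hall_pcore nilH sylS).
Qed.

(* [T] and [T :^ n] both centralise [x ^ n] and are Sylow in its centraliser in
   [N <*> T]; a conjugating element from ['C_N[x ^ n]] corrects [n] to an element
   of ['N_N(T)], which lies in the nilpotent group [L]. *)
Lemma nilpotent_overgroup_fusion (gT : finGroupType) (s t : nat) (N L S T : {group gT}) :
  s != t -> nilpotent L -> T \subset 'N(N) -> t.-Sylow(N <*> T) T ->
  T \subset L -> 'N_N(T) \subset L -> s.-Sylow(N) S -> S \subset L ->
  forall x n, x \in S -> n \in N -> x ^ n \in S ->
  exists2 u, u \in S & x ^ n = x ^ u.
Proof.
move=> neq_st nilL nNT sylT sTL sNTL sylS sSL x n Sx Nn Sxn.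
have coST : coprime #|S| #|T|.
  apply: (@pnat_coprime s); first exact: pHall_pgroup sylS.
  apply: sub_in_pnat (pHall_pgroup sylT) => q _ /eqP ->.
  by rewrite inE /= inE eq_sym.
have cST : T \subset 'C(S) by apply: sub_nilpotent_cent2 nilL _ _ _.
have cxT y : y \in S -> T \subset 'C[y].
  by move=> Sy; rewrite -cent_set1 (subset_trans cST) ?centS ?sub1set.
have sTC : T \subset 'C_(N <*> T)[x ^ n] by rewrite subsetI joing_subr cxT.
have NTn : n \in N <*> T by rewrite mem_gen // inE Nn.
have sTnC : T :^ n \subset 'C_(N <*> T)[x ^ n].
  rewrite subsetI; apply/andP; split.
    by rewrite -(conjGid NTn) conjSg joing_subr.
  by rewrite cent1J conjSg cxT.
have sylTC : t.-Sylow('C_(N <*> T)[x ^ n]) T.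
  exact: pHall_subl sTC (subsetIl _ _) sylT.
have sylTnC : t.-Sylow('C_(N <*> T)[x ^ n]) (T :^ n)%G.
  by apply: pHall_subl sTnC (subsetIl _ _) _; rewrite pHallJ.
have [c Cc /= defTn] := Sylow_trans sylTC sylTnC.
have : c \in T * N :&: 'C[x ^ n].
  by rewrite -(norm_joinEl nNT) joingC.
rewrite -group_modl ?cxT // => /mulsgP[b a Tb /setIP[Na cxa] def_c].
have NTa : n * a^-1 \in 'N_N(T).
  apply/setIP; split; first by rewrite groupM ?groupV.
  by apply/normP; rewrite conjsgM defTn def_c conjsgM (conjGid Tb) conjsgK.
have xna : x ^ n = x ^ (n * a^-1).
  rewrite conjgM [RHS](conjg_fixP _) //; apply/commgP.
  exact/commuteV/commute_sym/cent1P.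
rewrite xna; apply: (@nilpotent_Sylow_fusion _ s (N :&: L)%G) => //.
- exact: nilpotentS (subsetIr _ _) nilL.
- apply: pHall_subl (subsetIl _ _) (sylS).
  by rewrite subsetI (pHall_sub sylS).
by rewrite inE (subsetP sNTL) // andbT; case/setIP: NTa.
Qed.

(** * Maximal overgroups of Sylow normalisers *)

(** [S] is also Sylow in the normal subgroup [K :&: L], so the Frattini argument gives
    [G = (K :&: L) * 'N_G(S)]. *)
Lemma Frattini_sub_normal (gT : finGroupType) (p : nat) (G K L S : {group gT}) :
  K <| G -> p.-Sylow(K) S -> L <| G -> 'N_G(S) \subset L -> G \subset L.
Proof.
move=> nsKG sylS nsLG sNL; have [sSK sKG] := (pHall_sub sylS, normal_sub nsKG).
have sSL : S \subset L.
  by apply: subset_trans sNL; rewrite subsetI normG (subset_trans sSK).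
have sylSI : p.-Sylow(K :&: L) S.
  by apply: pHall_subl (subsetIl _ _) (sylS); rewrite subsetI sSK.
by rewrite -(Frattini_arg (normalI nsKG nsLG) sylSI) mul_subG ?subsetIr.
Qed.

Lemma Sylow_norm_maximal (gT : finGroupType) (p : nat) (G K S : {group gT}) :
  K <| G -> p.-Sylow(K) S -> ~~ (S <| G) ->
  exists L : {group gT}, [/\ maximal L G, 'N_G(S) \subset L & ~~ (L <| G)].
Proof.
move=> nsKG sylS n'SG.
have sSG : S \subset G := subset_trans (pHall_sub sylS) (normal_sub nsKG).
have [NG | [L maxL sNL]] := maximal_exists (subsetIl G 'N(S)).
  by case/negP: n'SG; rewrite /normal sSG -{1}NG subsetIr.
exists L; split=> //; apply/negP => nsLG.
have := maxgroupp maxL; rewrite properE.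
by rewrite (Frattini_sub_normal nsKG sylS nsLG sNL) andbF.
Qed.

(** * Solvability *)

(** Induction on [#|G| - #|D|]. A Sylow subgroup [S] of [G] over ['O_p('N_G(D))] contains both
    ['N_P(D)] and ['N_Q(D)]; these are larger than [D], so [P] and [Q] both equal [S]. *)
Lemma nilpotent_local_Sylow_TI (gT : finGroupType) (p : nat) (G D P Q : {group gT}) :
  (forall E : {group gT},
     p.-group E -> E \subset G -> E :!=: 1 -> nilpotent 'N_G(E)) ->
  p.-Sylow(G) P -> p.-Sylow(G) Q -> D :!=: 1 -> D \subset P -> D \subset Q ->
  P :=: Q.
Proof.
move=> nilN; have [n] := ubnP (#|G| - #|D|).
elim: n D P Q => // n IHn D P Q leGD sylP sylQ ntD sDP sDQ.
have eqPQ : #|P| = #|Q| by rewrite (card_Hall sylP) (card_Hall sylQ).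
have [defD|neqDP] := eqVneq (D : {set gT}) P.
  by apply/eqP; rewrite eqEcard eqPQ leqnn -defD sDQ.
have [defD|neqDQ] := eqVneq (D : {set gT}) Q.
  by apply/esym/eqP; rewrite eqEcard eqPQ leqnn -defD sDP.
have sDG := subset_trans sDP (pHall_sub sylP).
have pD := pgroupS sDP (pHall_pgroup sylP).
have sylE := nilpotent_pcore_Hall p (nilN D pD sDG ntD).
have [|S sylS sES] := @Sylow_superset p _ G 'O_p('N_G(D))%G _ (pcore_pgroup _ _).
  by rewrite (subset_trans (pcore_sub _ _)) ?subsetIl.
have eqS (R : {group gT}) : p.-Sylow(G) R -> D \proper R -> R :=: S.
  move=> sylR prDR; have pR := pHall_pgroup sylR.
  have prDN := nilpotent_proper_norm (pgroup_nil pR) prDR.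
  apply: (IHn ('N_R(D))%G) => //.
  - have leNG := subset_leq_card (subset_trans (subsetIl R 'N(D)) (pHall_sub sylR)).
    apply: leq_trans (ltn_sub2l _ (proper_card prDN)) _ => //.
    exact: leq_trans (proper_card prDN) leNG.
  - by apply: subG1_contra ntD; apply: proper_sub.
  - exact: subsetIl.
  apply: subset_trans sES.
  rewrite (sub_normal_Hall sylE) ?pcore_normal ?setSI ?(pHall_sub sylR) //.
  exact: pgroupS (subsetIl _ _) pR.
have prDP : D \proper P by rewrite properEneq neqDP.
have prDQ : D \proper Q by rewrite properEneq neqDQ.
exact: etrans (eqS P sylP prDP) (esym (eqS Q sylQ prDQ)).
Qed.

Definition maximals_nil_normal_or_p' (gT : finGroupType) (p : nat) (G : {set gT}) :=
  forall M : {group gT}, maximal M G -> [\/ nilpotent M, M <| G | ~~ (p %| #|M|)].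

(** The product [#|K| * #|M|] is the order of the preimage of [M]: if [p] divides [#|K|], the third
    alternative disappears. *)
Lemma maximals_quotient (gT : finGroupType) (p : nat) (G K : {group gT}) :
  maximals_nil_normal_or_p' p G -> K <| G ->
  forall M : {group coset_of K}, maximal M (G / K) ->
  [\/ nilpotent M, M <| G / K | ~~ (p %| #|K| * #|M|)].
Proof.
move=> hG nsKG M; rewrite -cosetpre_maximal quotientGK // => /hG.
have -> : (coset K @*^-1 M <| G) = (M <| G / K).
  by rewrite -{1}(quotientGK nsKG) cosetpre_normal.
rewrite card_cosetpre.
case=> [nilM | nsM | p'M]; [apply: Or31 | exact: Or32 | exact: Or33].
by rewrite -(cosetpreK M) quotient_nil.
Qed.

Lemma Sylow_neq1 (gT : finGroupType) (p : nat) (G P : {group gT}) :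
  prime p -> p %| #|G| -> p.-Sylow(G) P -> P :!=: 1.
Proof.
move=> p_pr pG sylP.
by rewrite -cardG_gt1 (card_Hall sylP) p_part_gt1 mem_primes p_pr cardG_gt0.
Qed.

Lemma simple_maximals_sol (gT : finGroupType) (p : nat) (G : {group gT}) :
  simple G -> prime p -> p %| #|G| -> maximals_nil_normal_or_p' p G -> solvable G.
Proof.
case/simpleP=> ntG simG p_pr pG hG; apply: contraT => nsolG.
have nilN (E : {group gT}) : p.-group E -> E \subset G -> E :!=: 1 -> nilpotent 'N_G(E).
  move=> pE sEG ntE.
  have [NG | [L maxL sNL]] := maximal_exists (subsetIl G 'N(E)).
    have [|E1|EG] := simG E; first by rewrite /normal sEG -{1}NG subsetIr.
      by rewrite E1 eqxx in ntE.
    by case/negP: nsolG; rewrite -EG (pgroup_sol pE).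
  have pL : p %| #|L|.
    have [_ pdvE _] := pgroup_pdiv pE ntE; apply: dvdn_trans pdvE (cardSg _).
    by apply: subset_trans sNL; rewrite subsetI sEG normG.
  have prL := maxgroupp maxL.
  have [nilL | nsL | ] := hG L maxL; last by rewrite pL.
    exact: nilpotentS nilL.
  have [L1|LG] := simG L nsL; last by rewrite LG properxx in prL.
  by move: pL; rewrite L1 cards1 dvdn1 => /eqP p1; rewrite p1 in p_pr.
have [P sylP] := Sylow_exists p G.
have ntP := Sylow_neq1 p_pr pG sylP.
have G'neq : G^`(1) != G.
  apply: (fusion_der1_neq sylP ntP) => x g Px Gg Pxg.
  have [x1 | ntx] := eqVneq x 1; first by exists 1; rewrite ?group1 // x1 !conj1g.
  (* The nontrivial element [x ^ g] lies in both Sylow subgroups, so [g] normalises [P]. *)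
  have eqP : P :=: (P :^ g)%G.
    apply: (@nilpotent_local_Sylow_TI _ p G <[x ^ g]>%G) => //.
    - by rewrite pHallJ.
    - by rewrite cycle_eq1 conjg_eq1.
    - by rewrite cycle_subG.
    - by rewrite cycle_subG memJ_conjg.
  have nilNP := nilN P (pHall_pgroup sylP) (pHall_sub sylP) ntP.
  apply: (@nilpotent_Sylow_fusion _ p _ P _ _ nilNP) => //.
    by rewrite /= Sylow_subnorm.
  by rewrite inE Gg; apply/normP.
have [G'1 | G'G] := simG _ (der_normal 1 G); last by rewrite G'G eqxx in G'neq.
by case/negP: nsolG; apply/abelian_sol/commG1P.
Qed.

(** Hence every prime divisor of [#|G / N|] divides the order of any subgroup over ['N_G(S)]. *)
Lemma Frattini_quotient (gT : finGroupType) (p : nat) (G N S : {group gT}) :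
  N <| G -> p.-Sylow(N) S -> #|G / N| %| #|'N_G(S)|.
Proof.
by move=> nsNG sylS; rewrite -{1}(Frattini_arg nsNG sylS) quotientMidl dvdn_quotient.
Qed.

Lemma maximals_sol (gT : finGroupType) (p : nat) (G : {group gT}) :
  prime p -> p %| #|G| -> maximals_nil_normal_or_p' p G -> solvable G.
Proof.
have [n] := ubnP #|G|; elim: n gT p G => // n IHn gT p G leGn p_pr pG hG.
apply: contraT => nsolG.
have nosolK (K : {group gT}) : K <| G -> solvable K -> K :=: 1.
  move=> nsKG solK; apply/eqP; apply: contraR nsolG => ntK.
  rewrite (series_sol nsKG) solK /=.
  have [-> | ntGK] := eqVneq (G / K) 1; first exact: solvable1.
  have ltGK : #|G / K| < n.
    exact: leq_trans (ltn_quotient ntK (normal_sub nsKG)) leGn.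
  have hGK := maximals_quotient hG nsKG.
  have [pK | p'K] := boolP (p %| #|K|).
    (* Every maximal subgroup of [G / K] is now nilpotent or normal, so any prime divisor of
       [#|G / K|] can take the role of [p]. *)
    apply: (IHn _ (pdiv #|G / K|)) => //.
    - by rewrite pdiv_prime // cardG_gt1.
    - exact: pdiv_dvd.
    move=> M /hGK[]; [exact: Or31 | exact: Or32 | by rewrite dvdn_mulr].
  apply: (IHn _ p) => //.
    move: pG; rewrite -(LagrangeI G K) (setIidPr (normal_sub nsKG)) Euclid_dvdM //.
    by rewrite (negPf p'K) -card_quotient ?normal_norm.
  move=> M /hGK[]; [exact: Or31 | exact: Or32 |].
  by rewrite Euclid_dvdM // negb_or p'K => p'M; apply: Or33.
have ntG : G :!=: 1 by apply: contraNneq nsolG => ->; apply: solvable1.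
have [N minN sNG] := minnormal_exists ntG (normG G).
have /mingroupP[/andP[ntN nNG] minN'] := minN.
have nsNG : N <| G by apply/andP.
have nsolN : ~~ solvable N by apply: contra ntN => /(nosolK _ nsNG)->.
have N'N : N^`(1) = N.
  apply: minN'; last exact: der_sub.
  rewrite (char_norm_trans (der_char 1 N) nNG) andbT; apply: contraNneq nsolN => N'1.
  exact/abelian_sol/commG1P.
have nnS (s : nat) (S : {group gT}) : s.-group S -> S :!=: 1 -> ~~ (S <| G).
  by move=> sS; apply: contra => nsS; apply/eqP; exact: nosolK nsS (pgroup_sol sS).
(* The Sylow [t]-subgroup [T] of [L] is normal in [L] but not in [G], so [L = 'N_G(T)] and [T] is
   Sylow in [G]. Fusion in [S] is then controlled by [S], against [N'N]. *)
have two_primes (s t : nat) (S L : {group gT}) : s.-Sylow(N) S -> S :!=: 1 -> prime t ->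
    s != t -> maximal L G -> nilpotent L -> 'N_G(S) \subset L -> t %| #|L| -> False.
  move=> sylS ntS t_pr neq_st maxL nilL sNL tL.
  have [prLG maxL'] := maxgroupP maxL.
  have [T sylT] := Sylow_exists t L.
  have ntT := Sylow_neq1 t_pr tL sylT.
  have [sTL tT] := (pHall_sub sylT, pHall_pgroup sylT).
  have sLG := proper_sub prLG; have sTG := subset_trans sTL sLG.
  have defNT : 'N_G(T) = L.
    apply: maxL'; last first.
      rewrite subsetI sLG normal_norm // (nilpotent_Hall_pcore nilL sylT).
      exact: pcore_normal.
    rewrite properE subsetIl subsetI subxx /=; apply: contra (nnS _ T tT ntT).
    by rewrite /normal sTG.
  have sylTG : t.-Sylow(G) T by rewrite -Sylow_subnorm defNT.
  have /eqP[] // : N^`(1) != N.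
  apply: (fusion_der1_neq sylS ntS).
  apply: (nilpotent_overgroup_fusion neq_st nilL _ _ sTL _ sylS).
  - exact: subset_trans sTG nNG.
  - apply: pHall_subl (joing_subr _ _) _ sylTG.
    by rewrite join_subG sNG.
  - by rewrite -defNT setSI.
  apply: subset_trans sNL; rewrite subsetI normG andbT.
  exact: subset_trans (pHall_sub sylS) sNG.
(* [pcase] ensures that [p] divides the order of a nonnormal maximal [L] over ['N_G(S)], which is
   therefore nilpotent. *)
have nilpotent_over s : prime s -> s %| #|N| -> p = s \/ p %| #|G / N| ->
    forall t, prime t -> t %| #|G / N| -> s = t.
  move=> s_pr sN pcase t t_pr tGN; apply/eqP; apply: contraT => neq_st.
  have [S sylS] := Sylow_exists s N; have ntS := Sylow_neq1 s_pr sN sylS.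
  have [sS sSN] := (pHall_pgroup sylS, pHall_sub sylS).
  have [L [maxL sNL nnL]] := Sylow_norm_maximal nsNG sylS (nnS _ _ sS ntS).
  have dvdL := dvdn_trans (Frattini_quotient nsNG sylS) (cardSg sNL).
  have pL : p %| #|L|.
    case: pcase => [->|/dvdn_trans->//].
    have [_ pS _] := pgroup_pdiv sS ntS; apply: dvdn_trans pS (cardSg _).
    by apply: subset_trans sNL; rewrite subsetI normG (subset_trans sSN).
  have [nilL | nsL | ] := hG L maxL; [ | by rewrite nsL in nnL | by rewrite pL].
  by case: (two_primes s t S L) => //; apply: dvdn_trans tGN dvdL.
have [pGN | p'GN] := boolP (p %| #|G / N|).
  case/negP: nsolN; apply: (@pgroup_sol _ p).
  rewrite /pgroup; apply/pnatP => // s s_pr sN; rewrite inE /=.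
  by apply/eqP; exact: (nilpotent_over s s_pr sN (or_intror pGN) p p_pr pGN).
have pN : p %| #|N|.
  move: pG; rewrite -(LagrangeI G N) (setIidPr sNG) Euclid_dvdM //.
  by rewrite -card_quotient // (negPf p'GN) orbF.
have [GN1 | ntGN] := eqVneq (G / N) 1.
  case/negP: (nsolG); apply: (@simple_maximals_sol _ p) => //.
  suff eqNG : N :=: G by rewrite /simple -{1}eqNG.
  by apply/eqP; rewrite eqEsubset sNG -quotient_sub1 // GN1 subxx.
(* With [s = p], each prime divisor of [#|G / N|] would be [p], which does not divide it. *)
have := nilpotent_over p p_pr pN (or_introl (erefl _)) (pdiv #|G / N|).
rewrite pdiv_prime ?cardG_gt1 // pdiv_dvd => /(_ isT isT) pE.
by rewrite pE pdiv_dvd in p'GN.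
Qed.

(** * Nilpotency criteria and lifting from quotients *)

Lemma nilpotent_maximal_normal (gT : finGroupType) (G M : {group gT}) :
  nilpotent G -> maximal M G -> M <| G.
Proof.
move=> nilG /maxgroupP[prMG maxM]; apply/andP; split; first exact: proper_sub.
have prMN := nilpotent_proper_norm nilG prMG.
have [NG | ltNG] := eqVproper (subsetIl G 'N(M)); first by rewrite -{1}NG subsetIr.
by have := prMN; rewrite (maxM ('N_G(M))%G ltNG (proper_sub prMN)) properxx.
Qed.

(** A nonnormal Sylow subgroup would yield a nonnormal maximal one; so all Sylow subgroups lie in
    the Fitting subgroup. *)
Lemma maximals_normal_nilpotent (gT : finGroupType) (G : {group gT}) :
  (forall M : {group gT}, maximal M G -> M <| G) -> nilpotent G.
Proof.
move=> nsM; apply: nilpotentS (Fitting_nil G); rewrite -{1}(Sylow_gen G) gen_subG.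
apply/bigcupsP => P /SylowP[p _ sylP]; apply: Fitting_max; last first.
  exact: pgroup_nil (pHall_pgroup sylP).
apply: contraT => nnP.
by have [L [/nsM->]] := Sylow_norm_maximal (normal_refl G) sylP nnP.
Qed.

Lemma p'group_coprime (gT : finGroupType) (q : nat) (K : {group gT}) :
  prime q -> q^'.-group K = coprime #|K| q.
Proof. by move=> q_pr; rewrite /pgroup p'natE // coprime_sym prime_coprime. Qed.

Lemma nilpotent_q_nilpotent (gT : finGroupType) (q : nat) (G : {group gT}) :
  prime q -> nilpotent G -> q_nilpotent q G.
Proof.
move=> q_pr nilG; exists 'O_q^'(G)%G; rewrite pcore_normal -p'group_coprime //.
rewrite pcore_pgroup; have /and3P[_ _] := nilpotent_pcore_Hall q^' nilG.
by rewrite pnatNK.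
Qed.

Lemma q_nilpotent_lift (gT : finGroupType) (q : nat) (G K : {group gT}) :
  prime q -> K <| G -> q^'.-group K -> q_nilpotent q (G / K) -> q_nilpotent q G.
Proof.
move=> q_pr nsKG q'K [H [nsH [coH qH]]]; exists (coset K @*^-1 H)%G.
split; first by rewrite -(quotientGK nsKG) cosetpre_normal.
rewrite card_cosetpre coprimeMl -p'group_coprime // q'K coH; split=> //.
by rewrite -{1}(quotientGK nsKG) index_cosetpre.
Qed.

(** [K <*> Q] is the preimage of a normal subgroup; as [K] is central, [Q] is its normal Sylow
    subgroup, hence characteristic in it. *)
Lemma q_closed_lift (gT : finGroupType) (q : nat) (G K : {group gT}) :
  K \subset 'Z(G) -> q_closed q (G / K) -> q_closed q G.
Proof.
rewrite subsetI => /andP[sKG cGK] [Qb [sylQb nsQb]].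
have nsKG : K <| G by rewrite /normal sKG cents_norm // centsC.
have [nKG [Q sylQ]] := (normal_norm nsKG, Sylow_exists q G).
have sQG := pHall_sub sylQ; have nKQ := subset_trans sQG nKG.
exists Q; split; first by rewrite inE.
have defQb : Q / K = Qb.
  move: sylQb; rewrite inE => sylQb; have sylQK := quotient_pHall nKQ sylQ.
  have [x Gx ->] := Sylow_trans sylQb sylQK.
  exact/normP/(subsetP (normal_norm nsQb)).
have nsKQ : K <*> Q <| G.
  by rewrite -(quotientYK nKQ) defQb -(quotientGK nsKG) cosetpre_normal.
have sylQKQ : q.-Sylow(K <*> Q) Q.
  exact: pHall_subl (joing_subr _ _) (normal_sub nsKQ) sylQ.
have nsQKQ : Q <| K <*> Q.
  rewrite /normal joing_subr join_subG normG andbT cents_norm //.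
  by rewrite centsC (subset_trans sQG) // centsC.
rewrite -(normal_Hall_pcore sylQKQ nsQKQ).
exact: char_normal_trans (pcore_char _ _) nsKQ.
Qed.

(** * Nilpotent maximal subgroups that are not normal *)

Lemma nilpotent_maximal_Sylow_gcore (gT : finGroupType) (G M : {group gT}) :
  solvable G -> maximal M G -> nilpotent M -> ~~ (M <| G) ->
  exists r : nat, exists2 R : {group gT}, r.-Sylow(G) R &
    gcore M G <*> R <| G /\ R * M = G.
Proof.
move=> solG maxM nilM nnM; have [prMG maxM'] := maxgroupP maxM.
have sMG := proper_sub prMG; set C := gcore M G.
have [sCM nsCG] : C \subset M /\ C <| G by rewrite gcore_sub gcore_normal.
have ntGC : G / C != 1.
  by rewrite quotient_neq1 // (sub_proper_trans sCM).
have [H [sHG nsHG ntH]] :=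
  solvable_norm_abelem (quotient_sol C solG) (normal_refl _) ntGC.
case/is_abelemP => r r_pr /abelem_pgroup rH; exists r.
have [R sylR] := Sylow_exists r G; have sRG := pHall_sub sylR.
have nCR := subset_trans sRG (normal_norm nsCG).
exists R => //.
pose N := (coset C @*^-1 H)%G.
have nsNG : N <| G by rewrite -(quotientGK nsCG) cosetpre_normal.
(* The core [C] is the largest normal subgroup of [G] inside [M], and [N] is larger. So [N * M = G],
   and [G / N] is nilpotent as an image of [M]. *)
have nsNM : ~~ (N \subset M).
  apply: contra ntH => sNM; rewrite -(cosetpreK H) -subG1 quotient_sub1 ?subsetIl //.
  by rewrite gcore_max // normal_norm.
have NMG : N * M = G.
  have nNM := subset_trans sMG (normal_norm nsNG).
  rewrite -norm_joinEr //; apply/eqP; apply: contraR nsNM => neqG.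
  rewrite -(maxM' (N <*> M)%G) ?joing_subl ?joing_subr //.
  by rewrite properEneq neqG join_subG normal_sub.
have sylRC := quotient_pHall nCR sylR.
have sHR : H \subset R / C.
  by rewrite (normal_sub_max_pgroup (Hall_max sylRC)).
have nilGH : nilpotent (G / C / H).
  have defGC : N * M / C = H * (M / C) by rewrite quotientMl ?subsetIl // cosetpreK.
  by rewrite NMG in defGC; rewrite defGC quotientMidl !quotient_nil.
have nsRC : R / C <| G / C.
  have nHR : R / C \subset 'N(H).
    exact: subset_trans (quotientS _ sRG) (normal_norm nsHG).
  have nsH : H <| R / C by rewrite /normal sHR.
  have : R / C / H <| G / C / H.
    by rewrite (nilpotent_Hall_pcore nilGH (quotient_pHall nHR sylRC)) pcore_normal.
  by rewrite -cosetpre_normal !quotientGK.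
have nsCR : C <*> R <| G.
  by have := nsRC; rewrite -cosetpre_normal quotientYK ?quotientGK.
split=> //; apply/eqP; rewrite eqEsubset mul_subG //=.
have sNCR : N \subset C <*> R.
  by rewrite -(quotientYK nCR) cosetpreSK.
have := mulSg M sNCR; rewrite NMG => /subset_trans-> //.
by rewrite norm_joinEr // -(normC nCR) -mulgA mulgS // mul_subG.
Qed.

(** If [R] is normal, [G / R] is an image of [M], hence nilpotent. Otherwise take [L] over
    ['N_G(R)]: Frattini in [C <*> R] gives [C * L = G], and a nilpotent [L] would make [G / C]
    nilpotent and [M] normal. *)
Lemma q_nilpotent_closed_or_gcore_supplement (gT : finGroupType) (G M : {group gT}) :
  solvable G -> maximal M G -> nilpotent M -> ~~ (M <| G) ->
  (forall q, prime q -> q_nilpotent q G \/ q_closed q G) \/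
  exists L : {group gT},
    [/\ maximal L G, ~~ (L <| G), ~~ nilpotent L & gcore M G * L = G].
Proof.
move=> solG maxM nilM nnM.
have [r [R sylR [nsCR RMG]]] := nilpotent_maximal_Sylow_gcore solG maxM nilM nnM.
have sMG := proper_sub (maxgroupp maxM).
have [nsR | nnR] := boolP (R <| G); [left=> q q_pr | right].
  have [-> | neq_qr] := eqVneq q r; first by right; exists R; rewrite inE.
  left; apply: (q_nilpotent_lift q_pr nsR).
    apply: sub_in_pnat (pHall_pgroup sylR) => s _ /eqP->.
    by rewrite inE /= inE eq_sym.
  by apply: nilpotent_q_nilpotent => //; rewrite /= -{1}RMG quotientMidl quotient_nil.
have sRG := pHall_sub sylR; set C := gcore M G in nsCR *.
have nsCG : C <| G by apply: gcore_normal.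
have sylRC : r.-Sylow(C <*> R) R.
  exact: pHall_subl (joing_subr _ _) (normal_sub nsCR) sylR.
have [L [maxL sNL nnL]] := Sylow_norm_maximal nsCR sylRC nnR.
have sLG := proper_sub (maxgroupp maxL).
have CLG : C * L = G.
  apply/eqP; rewrite eqEsubset mul_subG ?(normal_sub nsCG) //=.
  have defG := Frattini_arg nsCR sylRC.
  rewrite /= norm_joinEr ?(subset_trans sRG) ?normal_norm // -mulgA in defG.
  have : C * (R * 'N_G(R)) \subset C * L.
    rewrite mulgS // mul_subG // (subset_trans _ sNL) //.
    by rewrite subsetI sRG normG.
  by rewrite defG.
exists L; split=> //; apply: contra nnM => nilL.
have nilGC : nilpotent (G / C).
  by have := quotientMidl C L; rewrite CLG => ->; apply: quotient_nil.
have nsCM : C <| M by rewrite (normalS _ sMG) ?gcore_sub.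
have := @nilpotent_maximal_normal _ (G / C)%G (M / C)%G nilGC.
rewrite quotient_maximal // => /(_ maxM).
by rewrite -(cosetpre_normal (M / C) (G / C)) !quotientGK.
Qed.

Lemma complemented_normal_Sylow_central
    (gT : finGroupType) (p : nat) (G M L P : {group gT}) :
  p.-Sylow(G) P -> P <| G -> P :!=: 1 ->
  maximal L G -> p^'.-group L ->
  maximal M G -> nilpotent M -> ~~ (M <| G) -> P \subset M ->
  P \subset 'Z(G).
Proof.
move=> sylP nsPG ntP maxL p'L maxM nilM nnM sPM.
have [[prLG maxL'] [prMG maxM']] := (maxgroupP maxL, maxgroupP maxM).
have pP := pHall_pgroup sylP; have sPG := pHall_sub sylP.
have [sLG sMG] := (proper_sub prLG, proper_sub prMG).
have tiPL (Z : {group gT}) : p.-group Z -> Z :&: L = 1.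
  by move=> pZ; apply: coprime_TIg (pnat_coprime pZ p'L).
have pZ : p.-group 'Z(P) := pgroupS (center_sub P) pP.
have ntZ : 'Z(P) != 1 by apply: contraNneq ntP => /(trivg_center_pgroup pP)->.
have nsZG : 'Z(P) <| G := char_normal_trans (center_char P) nsPG.
(* The maximal [p']-group [L] cannot contain ['Z(P)]. By the modular law
   [P = 'Z(P) * (L :&: P) = 'Z(P)]. *)
have ZLG : 'Z(P) * L = G.
  have nZL := subset_trans sLG (normal_norm nsZG).
  rewrite -norm_joinEr //; apply/eqP; apply: contraR ntZ => neqG.
  rewrite -(tiPL 'Z(P)%G pZ); apply/eqP/esym/setIidPl.
  rewrite -(maxL' ('Z(P) <*> L)%G) ?joing_subl ?joing_subr //.
  by rewrite properEneq neqG join_subG normal_sub.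
have abP : abelian P.
  have := group_modl L (center_sub P).
  by rewrite ZLG (setIidPr sPG) setIC tiPL // mulg1 => /center_idP.
(* [P] is abelian and is the Sylow [p]-subgroup of the nilpotent [M]. As ['C_G(P)] is normal and [M]
   is not, maximality then leaves ['C_G(P) = G]. *)
have sMC : M \subset 'C_G(P).
  rewrite subsetI sMG /=.
  have defP := nilpotent_Hall_pcore nilM (pHall_subl sPM sMG sylP).
  have [_ defM cPp' _] := dprodP (nilpotent_pcoreC p nilM).
  have : 'O_p(M) * 'O_p^'(M) \subset 'C(P).
    by rewrite -defP in cPp' *; rewrite mul_subG.
  by rewrite defM.
have nsCG : 'C_G(P) <| G.
  by rewrite /normal subsetIl normsI ?normG ?norms_cent ?normal_norm.
have [CG | ltCG] := eqVproper (subsetIl G 'C(P)).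
  by rewrite subsetI sPG centsC -{1}CG subsetIr.
by case/negP: nnM; rewrite -(maxM' 'C_G(P)%G).
Qed.

(** [G / C] is an image of [L], so neither [#|G : C|] nor [#|C : 'O_p(C)|] involves [p]. *)
Lemma p'_supplement_pcore (gT : finGroupType) (p : nat) (G C L : {group gT}) :
  C <| G -> nilpotent C -> C * L = G -> p^'.-group L -> p.-Sylow(G) 'O_p(C).
Proof.
move=> nsCG nilC CLG p'L; have sylC := nilpotent_pcore_Hall p nilC.
have sLG : L \subset G by rewrite -CLG mulG_subr.
rewrite /pHall (subset_trans (pcore_sub _ _) (normal_sub nsCG)) pcore_pgroup /=.
rewrite -(Lagrange_index (normal_sub nsCG) (pcore_sub p C)) pnatM.
have [_ _ ->] := and3P sylC; rewrite andbT.
rewrite -card_quotient ?normal_norm //.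
have := quotientMidl C L; rewrite CLG => ->.
exact: quotient_pgroup.
Qed.

(** * No exceptional primes other than [p] *)

Lemma maximals_q_nilpotent_or_closed (gT : finGroupType) (p q : nat) (G : {group gT}) :
  prime p -> p %| #|G| -> maximals_nil_normal_or_p' p G -> prime q -> q != p ->
  q_nilpotent q G \/ q_closed q G.
Proof.
move=> p_pr pG hG q_pr neq_qp; have solG := maximals_sol p_pr pG hG.
have p_q' (A : {set gT}) : p.-group A -> q^'.-group A.
  by apply: sub_in_pnat => s _ /eqP->; rewrite inE /= inE eq_sym.
have pgroup_dvd (A : {group gT}) : p^'.-group A = ~~ (p %| #|A|).
  by rewrite /pgroup p'natE.
have [exM | noM] :=
  boolP [exists M : {group gT}, [&& maximal M G, nilpotent M & ~~ (M <| G)]].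
  have /existsP[M /and3P[maxM nilM nnM]] := exM.
  have sMG := proper_sub (maxgroupp maxM).
  have [ | [L [maxL nnL nnilL CLG]]] :=
    q_nilpotent_closed_or_gcore_supplement solG maxM nilM nnM.
    exact.
  have p'L : p^'.-group L.
    rewrite pgroup_dvd; case: (hG L maxL) => //; first by rewrite (negPf nnilL).
    by rewrite (negPf nnL).
  have sCM := gcore_sub M G.
  have nsCG := gcore_normal sMG.
  have sylP := p'_supplement_pcore nsCG (nilpotentS sCM nilM) CLG p'L.
  set P := 'O_p(_) in sylP.
  have nsPG : P <| G := char_normal_trans (pcore_char _ _) nsCG.
  have ntP : P != 1 := Sylow_neq1 p_pr pG sylP.
  have sPM : P \subset M := subset_trans (pcore_sub _ _) sCM.
  have sPZ := complemented_normal_Sylow_central sylP nsPG ntP maxL p'L maxM nilM nnM sPM.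
  have nsPM : P <| M := normalS sPM sMG nsPG.
  have maxMP : maximal (M / P) (G / P) by rewrite quotient_maximal.
  have nnMP : ~~ (M / P <| G / P).
    by rewrite -cosetpre_normal !quotientGK.
  have [solGP nilMP] := (quotient_sol P solG, quotient_nil P nilM).
  case: (q_nilpotent_closed_or_gcore_supplement solGP maxMP nilMP nnMP).
    case/(_ q q_pr) => [nilq | clq]; [left | right].
      exact: q_nilpotent_lift (p_q' _ (pHall_pgroup sylP)) nilq.
    exact: q_closed_lift sPZ clq.
  (* The preimage of [L'] contains [P], so its order is divisible by [p] and no alternative is left
     for it. *)
  case=> L' [maxL' nnL' nnilL' _].
  case: (maximals_quotient hG nsPG maxL'); first by rewrite (negPf nnilL').
    by rewrite (negPf nnL').
  rewrite dvdn_mulr //; have [_ ] := pgroup_pdiv (pHall_pgroup sylP) ntP.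
  by [].
have nsM (M : {group gT}) : maximal M G -> p %| #|M| -> M <| G.
  move=> maxM pM; case: (hG M maxM) => // [nilM | ]; last by rewrite pM.
  by apply: contraR noM => nnM; apply/existsP; exists M; rewrite maxM nilM.
have [P sylP] := Sylow_exists p G; have ntP := Sylow_neq1 p_pr pG sylP.
have [_ pP _] := pgroup_pdiv (pHall_pgroup sylP) ntP.
have nsPG : P <| G.
  apply: contraT => nnP.
  have [L [maxL sNL]] := Sylow_norm_maximal (normal_refl G) sylP nnP.
  rewrite nsM //; apply: dvdn_trans pP (cardSg _).
  by apply: subset_trans sNL; rewrite subsetI normG (pHall_sub sylP).
(* Maximal subgroups of [G / P] have preimages of order divisible by [p], hence normal; so [G / P]
   is nilpotent. *)
left; apply: (q_nilpotent_lift q_pr nsPG (p_q' _ (pHall_pgroup sylP))).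
apply: nilpotent_q_nilpotent => //; apply: maximals_normal_nilpotent => M maxM.
rewrite -cosetpre_normal quotientGK //; apply: nsM.
  by rewrite -(quotientGK nsPG) cosetpre_maximal.
by rewrite card_cosetpre dvdn_mulr.
Qed.

Theorem theorem1p7 (gT : finGroupType) (G : {group gT}) (p : nat) :
  prime p -> p %| #|G| ->
  (forall M : {group gT}, maximal M G ->
     [\/ nilpotent M, M <| G | ~~ (p %| #|M|)]) ->
  forall q1 q2 : nat,
    prime q1 -> q1 %| #|G| -> q1 != p ->
    ~ q_nilpotent q1 G -> ~ q_closed q1 G ->
    prime q2 -> q2 %| #|G| -> q2 != p ->
    ~ q_nilpotent q2 G -> ~ q_closed q2 G ->
    q1 = q2.
Proof.
move=> p_pr pG hG q1 q2 q1_pr _ neq_q1p nnil ncl.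
by case: (maximals_q_nilpotent_or_closed p_pr pG hG q1_pr neq_q1p).
Qed.
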